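(* Let $A\in\mathbb{C}^{n\times n}$ be normal, let $1\le k\le n$, and let $E=\theta H$ with $\theta\in\mathbb{T}_U$ and $H=H^*\in\mathbb{C}^{n\times n}$ be a $\theta$-Hermitian matrix of rank $k$. Then $A+E$ is normal if and only if $E$ can be decomposed as $$E=E_1+\dots+E_k,$$ where $E_1,\dots,E_k$ are $\theta$-Hermitian matrices of rank one such that $A+E_j$ is normal for each $j\in\{1,\dots,k\}$. In fact, for each permutation $\sigma$ of $\{1,\dots,k\}$ and each $m\in\{1,\dots,k\}$, the matrix $$A+\sum_{j=1}^m E_{\sigma(j)}$$ is then normal, too.
   Context: $\mathbb{T}_U=\{\tau\in\mathbb{C}:|\tau|=1,\ \arg(\tau)\in[0,\pi)\}$. For unimodular $\theta$, a square complex matrix $M$ is called $\theta$-Hermitian if $\overline{\theta}M$ is Hermitian. *)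

(* Defs.v *)
From mathcomp Require Import all_boot all_order all_fingroup all_algebra.
From mathcomp Require Import complex.
From mathcomp Require Import reals trigo.

Set Implicit Arguments.
Unset Strict Implicit.
Unset Printing Implicit Defensive.

Import Order.TTheory GRing.Theory Num.Theory.

Local Open Scope ring_scope.

(* R[i] is the field of complex numbers when R : realType. *)

(* The libraries provide no arg function; t is one of the arguments of z when
   z = |z| (cos t + i sin t). *)
Definition is_arg (R : realType) (z : R[i]) (t : R) : Prop :=
  z = `|z| * Complex (cos t) (sin t).

(* For z != 0 at most one t in [0, pi) satisfies is_arg z t, and it is the
   principal value both for the branch (-pi, pi] and for [0, 2 pi). *)
Definition upper_unimodular (R : realType) (tau : R[i]) : Prop :=
  `|tau| = 1 /\ exists t : R, 0 <= t < pi /\ is_arg tau t.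

Definition theta_hermitian (R : realType) (n : nat) (theta : R[i])
    (M : 'M[R[i]]_n) : Prop :=
  Num.conj theta *: M \is hermsymmx.

Definition normal_rank1_decomposition (R : realType) (n k : nat)
    (A : 'M[R[i]]_n) (theta : R[i]) (E : 'M[R[i]]_n)
    (E_ : 'I_k -> 'M[R[i]]_n) : Prop :=
  E = \sum_(j < k) E_ j /\
  forall j : 'I_k,
    [/\ theta_hermitian theta (E_ j), \rank (E_ j) = 1%N
      & A + E_ j \is normalmx].

(* Main.v *)
(* Writing E = theta H, expanding the commutator of A + E with its adjoint shows
   that A + E is normal exactly when H commutes with the skew-Hermitian matrix
   K = theta^* A - theta A^*.  This condition is linear in H, so it passes to
   sums of perturbations.  Conversely H and K are the Hermitian and
   skew-Hermitian parts of the normal matrix N = H + K, so a unitary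
   diagonalization of N diagonalizes both; the nonzero eigenvalues of H then give
   rank-one Hermitian summands, each commuting with K. *)
Require Import Defs.
From mathcomp Require Import all_boot all_order all_fingroup all_algebra.
From mathcomp Require Import complex.
From mathcomp Require Import reals trigo.
From mathcomp Require Import ring.

Import GRing.Theory Num.Theory.

Local Open Scope ring_scope.
Local Open Scope sesquilinear_scope.

Lemma hermsymmxP {C : numClosedFieldType} {n : nat} {M : 'M[C]_n} :
  reflect (M^t* = M) (M \is hermsymmx).
Proof.
by apply: (iffP (is_hermitianmxP _ _ _)) => [{2}->|{1}<-];
  rewrite expr0 scale1r.
Qed.

(** In the commutator of [A + theta *: H] with its adjoint, the terms in [A] alone cancel by
    normality, and the two terms quadratic in [H] carry the same factor [theta * theta^*]. Only the
    cross terms remain, and they regroup into the commutator on the right. *)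
Lemma normalmxD_scale_herm {C : numClosedFieldType} {n : nat} (theta : C)
    {A H : 'M[C]_n} :
  A \is normalmx -> H \is hermsymmx ->
  (A + theta *: H \is normalmx) <->
  comm_mx (theta^* *: A - theta *: A^t*) H.
Proof.
move=> /normalmxP AA /hermsymmxP HH.
have E : (A + theta *: H) *m (A + theta *: H)^t* -
         (A + theta *: H)^t* *m (A + theta *: H) =
         (theta^* *: A - theta *: A^t*) *m H -
         H *m (theta^* *: A - theta *: A^t*).
  rewrite linearD linearZ /= map_mxD map_mxZ HH.
  rewrite !(mulmxDl, mulmxDr, mulmxN, mulNmx) -!scalemxAl -!scalemxAr AA.
  by apply/matrixP => i j; rewrite !mxE; ring.
rewrite /comm_mx; split.
  by move/normalmxP/eqP; rewrite -subr_eq0 E subr_eq0 => /eqP.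
by move/eqP; rewrite -subr_eq0 -E subr_eq0 => /eqP/normalmxP.
Qed.

Lemma mxrank_diag {F : fieldType} {n : nat} (d : 'rV[F]_n) :
  \rank (diag_mx d) = #|[set i | d 0 i != 0]|.
Proof.
set S := [set i | _]; pose f : 'I_#|S| -> 'I_n := enum_val.
have fS i : d 0 (f i) != 0 by have := enum_valP i; rewrite inE.
apply/eqP; rewrite eqn_leq; apply/andP; split.
  (* Upper bound: the columns outside [S] vanish, so the matrix factors through dimension [#|S|]. *)
  suff -> : diag_mx d = colsub f (diag_mx d) *m rowsub f 1%:M.
    by rewrite (leq_trans (mxrankM_maxl _ _)) ?rank_leq_col.
  apply/matrixP => i j; rewrite !mxE.
  under eq_bigr do rewrite !mxE.
  rewrite -(big_enum_val (A := mem S) (fun l => d 0 i *+ (i == l) * (l == j)%:R)) /=.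
  have [iS|] := boolP (i \in S).
    rewrite (bigD1 i) //= eqxx big1 ?addr0 ?mulr1n ?mulr_natr //.
    by move=> l /andP[_ /negPf nli]; rewrite eq_sym nli mulr0n mul0r.
  rewrite inE negbK => /eqP ->.
  by rewrite mul0rn big1 // => l _; rewrite mul0rn mul0r.
(* Lower bound: the principal submatrix on [S] is diagonal with nonzero entries, hence invertible,
   and it is a product with [diag_mx d] as a factor. *)
have sub : mxsub f f (diag_mx d) = diag_mx (\row_i d 0 (f i)).
  by apply/matrixP => i j; rewrite !mxE (inj_eq enum_val_inj).
have : mxsub f f (diag_mx d) \in unitmx.
  rewrite sub unitmxE det_diag unitfE; apply/prodf_neq0 => i _.
  by rewrite mxE.
move=> /mxrank_unit {1}<-.
have -> : mxsub f f (diag_mx d) = rowsub f 1%:M *m diag_mx d *m colsub f 1%:M.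
  by rewrite mulmx_colsub mulmx1 mul_rowsub_mx mul1mx -mxsubcr.
exact: leq_trans (mxrankM_maxl _ _) (mxrankM_maxr _ _).
Qed.

Lemma herm_skew_codiagonalization {C : numClosedFieldType} {n : nat}
    {H K : 'M[C]_n} :
  H \is hermsymmx -> K^t* = - K -> comm_mx K H ->
  exists (P : 'M[C]_n) (h g : 'rV[C]_n),
    [/\ P \is unitarymx, h \is a realmx, H = P^t* *m diag_mx h *m P
      & K = P^t* *m diag_mx g *m P].
Proof.
move=> /hermsymmxP HH KK KH.
have NC : (H + K)^t* = H - K by rewrite linearD /= map_mxD HH KK.
have /orthomx_spectralP : H + K \is normalmx.
  apply/normalmxP; rewrite NC !(mulmxDl, mulmxDr) !(mulmxN, mulNmx) KH.
  by apply/matrixP => i j; rewrite !mxE; ring.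
have Pu := spectral_unitarymx (H + K).
move: (spectralmx _) (spectral_diag _) Pu => P d Pu.
rewrite invmx_unitary // => NE.
(* The adjoint of [NE] diagonalizes [H - K] by the same [P] with conjugated eigenvalues. Half the
   sum and half the difference of the two give [H] and [K], with eigenvalues [Re d] and
   ['i * Im d]. *)
have := NC; rewrite {1}NE !trmx_mul !map_mxM mulmxA trmxCK.
rewrite tr_diag_mx map_diag_mx => NCE.
exists P, (map_mx (@Re C) d), ('i *: map_mx (@Im C) d); split=> //.
- by apply/mxOverP => i j; rewrite mxE Creal_Re.
- have -> : map_mx (@Re C) d = 2^-1 *: (d + map_mx Num.conj d).
    by apply/rowP => i; rewrite !mxE ReE mulrC.
  rewrite linearZ linearD /= -scalemxAr -scalemxAl mulmxDr mulmxDl -NE NCE.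
  by apply/matrixP => i j; rewrite !mxE; field.
- have -> : 'i *: map_mx (@Im C) d = 2^-1 *: (d - map_mx Num.conj d).
    by apply/rowP => i; rewrite !mxE ImE !mulrA -expr2 sqrCi; field.
  rewrite linearZ linearB /= -scalemxAr -scalemxAl mulmxBr mulmxBl -NE NCE.
  by apply/matrixP => i j; rewrite !mxE; field.
Qed.

(** Each nonzero eigenvalue of [H] is multiplied by the rank-one orthogonal projection onto its
    vector in a common eigenbasis of [H] and [K]. There are [\rank H] such eigenvalues, counted with
    multiplicity. *)
Lemma herm_rank1_decomposition {C : numClosedFieldType} {n : nat}
    {H K : 'M[C]_n} :
  H \is hermsymmx -> K^t* = - K -> comm_mx K H ->
  exists2 H_ : 'I_(\rank H) -> 'M[C]_n, H = \sum_j H_ j &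
    forall j, [/\ H_ j \is hermsymmx, \rank (H_ j) = 1%N & comm_mx K (H_ j)].
Proof.
move=> HH KK /(herm_skew_codiagonalization HH KK) [P [h [g]]].
move=> [Pu hR HE KE].
have Punit := unitarymx_unit Pu.
have PCunit : P^t* \in unitmx by rewrite -invmx_unitary ?unitmx_inv.
have rankP M : \rank (P^t* *m M *m P) = \rank M.
  by rewrite mxrankMfree ?row_free_unit // eqmxMfull ?row_full_unit.
pose S := [set i | h 0 i != 0].
have rankH : \rank H = #|S| by rewrite HE rankP mxrank_diag.
rewrite rankH.
pose W i := P^t* *m (h 0 i *: delta_mx i i) *m P.
exists (fun j : 'I_#|S| => W (enum_val j)).
  rewrite -(big_enum_val (A := mem S) W) /= /W.
  (* The indices outside [S] carry the eigenvalue zero and contribute nothing. *)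
  rewrite HE diag_mx_sum_delta mulmx_sumr mulmx_suml (bigID [in S]) /=.
  rewrite [X in _ + X]big1 ?addr0 // => i; rewrite inE negbK => /eqP ->.
  by rewrite scale0r mulmx0 mul0mx.
move=> j; have := enum_valP j; rewrite inE; rewrite /W.
move: (enum_val j) => i hi; split.
- apply/hermsymmxP; rewrite !trmx_mul !map_mxM mulmxA trmxCK linearZ /=.
  rewrite map_mxZ trmx_delta map_delta_mx; congr (_ *m (_ *: _) *m _).
  by apply/CrealP/(mxOverP _ _).
- by rewrite rankP mxrank_scale_nz // mxrank_delta.
- have PM M N : P^t* *m M *m P *m (P^t* *m N *m P) = P^t* *m (M *m N) *m P.
    by rewrite !mulmxA mulmxtVK.
  rewrite /comm_mx KE !PM -scalemxAl -scalemxAr.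
  congr (_ *m (_ *: _) *m _); apply/matrixP => a b.
  rewrite mul_diag_mx mul_mx_diag !mxE.
  by case: eqP => [->|]; case: eqP => [->|]; rewrite ?mulr0 ?mul0r // mulrC.
Qed.

Theorem theorem4p12 (R : realType) (n k : nat) (A E H : 'M[R[i]]_n)
    (theta : R[i])
    (hA : A \is normalmx)
    (hk : (1 <= k <= n)%N)
    (htheta : upper_unimodular theta)
    (hH : H \is hermsymmx)
    (hE : E = theta *: H)
    (hrank : \rank E = k) :
  (A + E \is normalmx <->
     exists E_ : 'I_k -> 'M[R[i]]_n,
       normal_rank1_decomposition A theta E E_) /\
  (forall E_ : 'I_k -> 'M[R[i]]_n,
     normal_rank1_decomposition A theta E E_ ->
     forall (sigma : 'S_k) (m : nat), (1 <= m <= k)%N ->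
       A + \sum_(j < k | (j < m)%N) E_ (sigma j) \is normalmx).
Proof.
have [theta1 _] := htheta.
have theta0 : theta != 0 by rewrite -normr_gt0 theta1 ltr01.
have thetaC : theta * theta^* = 1 by rewrite -normCK theta1 expr1n.
pose K := theta^* *: A - theta *: A^t*.
(* This writes a theta-Hermitian [M] as [theta] times a Hermitian matrix, so the commutation
   criterion applies to each summand and to their sums. *)
have thetaK M : M = theta *: (theta^* *: M) by rewrite scalerA thetaC scale1r.
have normal_comm M : theta_hermitian theta M ->
    A + M \is normalmx <-> comm_mx K (theta^* *: M).
  by move=> hM; rewrite {1}[M]thetaK; exact: normalmxD_scale_herm.
(* The free choice of [I], [Q] and [f] covers both the full sum and the permuted partial sums. *)
have normal_sum (E_ : 'I_k -> 'M[R[i]]_n) (I : finType) (Q : pred I)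
    (f : I -> 'I_k) : normal_rank1_decomposition A theta E E_ ->
    A + \sum_(i | Q i) E_ (f i) \is normalmx.
  move=> [_ hE_]; apply/normal_comm.
    apply/hermsymmxP; rewrite linear_sum /= linear_sum /= raddf_sum /=.
    apply: eq_bigr => i _; apply/hermsymmxP.
    by have [] := hE_ (f i).
  rewrite scaler_sumr; apply: comm_mx_sum => i _.
  by have [h1 _ /(normal_comm _ h1)] := hE_ (f i).
split; last by move=> E_ hE_ sigma m _; exact: normal_sum.
split=> [|[E_ hE_]]; last first.
  by have [-> _] := hE_; exact: (normal_sum _ _ xpredT id).
rewrite hE => /(normalmxD_scale_herm theta hA hH).
have KK : K^t* = - K.
  apply/matrixP => i j; rewrite !mxE rmorphB !rmorphM /= !conjCK.
  ring.
move=> /(herm_rank1_decomposition hH KK) [H_ HE hH_].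
have rankH : \rank H = k by rewrite -hrank hE mxrank_scale_nz.
(* The type of [H_] depends on [\rank H], so the family is generalized before the rank is replaced
   by [k]. *)
move: H_ HE hH_; rewrite rankH => H_ HE hH_.
exists (fun j => theta *: H_ j); split; first by rewrite HE scaler_sumr.
move=> j; have [h1 h2 h3] := hH_ j; split.
- by rewrite /theta_hermitian scalerA mulrC thetaC scale1r.
- by rewrite mxrank_scale_nz.
- exact/(normalmxD_scale_herm theta hA h1).
Qed.
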